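(* Let $\mathbf C=(\mathbf C,\otimes)$ and $\mathbf D=(\mathbf D,\odot)$ be symmetric (strict) monoidal categories such that $\mathbf C$ is closed relative to a full subcategory $\mathbf P\subset\mathbf C$ and $\mathbf D$ is coclosed relative to a full subcategory $\mathbf Q\subset\mathbf D$. Let $\mathbb M=(X,\mu_X,\eta_X)$ be a monoid in $\mathbf C$. Any contravariant colax monoidal functor $F=(F,\varphi,\phi)\colon(\mathbf C,\otimes)\to(\mathbf D,\odot)$ such that $F(\mathbf P)\subset\mathbf Q$ induces a contravariant functor $$F^{\mathbb M}_{\mathbf P}\colon\mathrm{Rep}_{\mathbf P}(\mathbb M)\to\mathrm{Corep}_{\mathbf Q}(\widetilde{\mathbb O}),$$ where $\widetilde{\mathbb O}=\mathrm{Comon}(F)\mathbb M$ is the comonoid in $\mathbf D$ given by $FX$ with comultiplication $\phi_{X,X}\cdot F\mu_X$ and counit $\varphi\cdot F\eta_X$. It maps an object $(V,\rho)$ to $(FV,\widetilde\omega)$, where $\widetilde\omega\colon\mathbf{coend}(FV)\to\widetilde{\mathbb O}$ is the corepresentation $$\mathbf{coend}(FV)\xrightarrow{\Phi_{V,V}}F\big(\mathbf{end}(V)\big)\xrightarrow{F\rho}FX.$$ A morphism $f\colon(V,\rho)\to(W,\tau)$ is mapped to the morphism $Ff\colon(FW,\widetilde\nu)\to(FV,\widetilde\omega)$, where $\widetilde\nu=F\tau\cdot\Phi_{W,W}$.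
   Context: Monoidal categories are strict; $f\cdot g$ denotes composition ($g$ first). $\mathbf C$ is closed relative to $\mathbf P$ if there are a bifunctor $\mathbf{hom}\colon\mathbf P^{op}\times\mathbf P\to\mathbf C$ and bijections $\theta_{X,V,W}\colon\mathrm{Hom}(X,\mathbf{hom}(V,W))\to\mathrm{Hom}(X\otimes V,W)$ natural in $X\in\mathbf C$, $V,W\in\mathbf P$. Put $\mathrm{ev}_{V,W}=\theta(\mathrm{id})$. For $V\in\mathbf P$, $\mathbf{end}(V)=\mathbf{hom}(V,V)$ is a monoid with multiplication $\theta^{-1}\big(\mathrm{ev}_{V,V}\cdot(\mathrm{id}\otimes\mathrm{ev}_{V,V})\big)$ and unit $\theta^{-1}(\mathrm{id}_V)$. $\mathrm{Rep}_{\mathbf P}(\mathbb M)$: objects are pairs $(V,\rho)$ with $V\in\mathbf P$ and $\rho\colon\mathbb M\to\mathbf{end}(V)$ a morphism of monoids; morphisms $(V,\rho)\to(W,\tau)$ are morphisms $f\colon V\to W$ in $\mathbf P$ with $\mathbf{hom}(\mathrm{id}_V,f)\cdot\rho=\mathbf{hom}(f,\mathrm{id}_W)\cdot\tau$. $\mathbf D$ is coclosed relative to $\mathbf Q$ if there are a bifunctor $\mathbf{cohom}\colon\mathbf Q^{op}\times\mathbf Q\to\mathbf D$ and bijections $\vartheta_{W,V,Z}\colon\mathrm{Hom}(\mathbf{cohom}(V,W),Z)\to\mathrm{Hom}(W,Z\odot V)$ natural in $V,W\in\mathbf Q$, $Z\in\mathbf D$. Put $\mathrm{coev}_{V,W}=\vartheta(\mathrm{id})$.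 For $V\in\mathbf Q$, $\mathbf{coend}(V)=\mathbf{cohom}(V,V)$ is a comonoid with comultiplication $\vartheta^{-1}\big((\mathrm{id}\odot\mathrm{coev}_{V,V})\cdot\mathrm{coev}_{V,V}\big)$ and counit $\vartheta^{-1}(\mathrm{id}_V)$. $\mathrm{Corep}_{\mathbf Q}(\mathbb O)$, for a comonoid $\mathbb O$ on an object $Y$: objects are pairs $(V,\omega)$ with $V\in\mathbf Q$ and $\omega\colon\mathbf{coend}(V)\to\mathbb O$ a morphism of comonoids; morphisms $(V,\omega)\to(W,\nu)$ are morphisms $f\colon V\to W$ in $\mathbf Q$ with $\omega\cdot\mathbf{cohom}(f,\mathrm{id}_V)=\nu\cdot\mathbf{cohom}(\mathrm{id}_W,f)$ as morphisms $\mathbf{cohom}(W,V)\to Y$. A contravariant functor $F\colon\mathbf C\to\mathbf D$ is colax monoidal if the corresponding covariant functor $\bar F\colon(\mathbf C^{op},\otimes)\to(\mathbf D,\odot)$ is equipped with a colax monoidal structure, with structure morphisms $\varphi\colon FI_{\mathbf C}\to I_{\mathbf D}$ and $\phi_{X,Y}\colon F(X\otimes Y)\to FX\odot FY$. For $V,W\in\mathbf P$, $\Phi_{V,W}=\vartheta^{-1}\big(\phi_{\mathbf{hom}(V,W),V}\cdot F(\mathrm{ev}_{V,W})\big)$; since $F$ is contravariant, $F(\mathrm{ev}_{V,W})\colon FW\to F(\mathbf{hom}(V,W)\otimes V)$, and thus $\Phi_{V,W}\colon\mathbf{cohom}(FV,FW)\to F\big(\mathbf{hom}(V,W)\big)$.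 *)

(* Defs.v *)
From mathcomp Require Import ssreflect ssrfun ssrbool.
From Stdlib Require Import ProofIrrelevance.

Set Implicit Arguments.
Unset Strict Implicit.
Unset Printing Implicit Defensive.

Declare Scope cat_scope.
Delimit Scope cat_scope with cat.
Local Open Scope cat_scope.

Reserved Notation "g ∘ f" (at level 40, left associativity).
Reserved Notation "A ⊗ B" (at level 35, right associativity).
Reserved Notation "f ⊗₁ g" (at level 35, right associativity).

Record Category := MkCategory {
  Obj :> Type;
  Hom : Obj -> Obj -> Type;
  idm : forall A, Hom A A;
  comp : forall A B C, Hom B C -> Hom A B -> Hom A C;
  comp1m : forall A B (f : Hom A B), comp (idm B) f = f;
  compm1 : forall A B (f : Hom A B), comp f (idm A) = f;
  compA : forall A B C D (h : Hom C D) (g : Hom B C) (f : Hom A B),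
    comp h (comp g f) = comp (comp h g) f }.

Arguments idm {c} A.
Notation "g ∘ f" := (comp g f) : cat_scope.

Definition op (C : Category) : Category :=
  @MkCategory C (fun A B => Hom B A) (fun A => idm A)
    (fun A B D (g : Hom D B) (f : Hom B A) => f ∘ g)
    (fun A B f => compm1 f) (fun A B f => comp1m f)
    (fun A B D E h g f => esym (compA f g h)).

Lemma pair_eta_eq (A B : Type) (a : A) (b : B) (q : A * B) :
  a = q.1 -> b = q.2 -> (a, b) = q.
Proof. by case: q => /= ? ? -> ->. Qed.

Definition prodcat (C D : Category) : Category :=
  @MkCategory (C * D)
    (fun p q => (Hom p.1 q.1 * Hom p.2 q.2)%type)
    (fun p => (idm p.1, idm p.2))
    (fun p q r g f => (g.1 ∘ f.1, g.2 ∘ f.2))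
    (fun p q f => pair_eta_eq (comp1m f.1) (comp1m f.2))
    (fun p q f => pair_eta_eq (compm1 f.1) (compm1 f.2))
    (fun p q r s h g f =>
       f_equal2 pair (compA h.1 g.1 f.1) (compA h.2 g.2 f.2)).

Definition Full (C : Category) (P : C -> Prop) : Category :=
  @MkCategory {V : C | P V} (fun V W => Hom (sval V) (sval W))
    (fun V => idm (sval V)) (fun U V W g f => g ∘ f)
    (fun V W f => comp1m f) (fun V W f => compm1 f)
    (fun V W U T h g f => compA h g f).

Definition fullm (C : Category) (P : C -> Prop) (V W : Full P) (f : Hom V W) :
  Hom (sval V) (sval W) := f.

Record FunctorData (C D : Category) := MkFunctorData {
  fobj :> C -> D;
  fmap : forall A B : C, Hom A B -> Hom (fobj A) (fobj B) }.

(* A contravariant functor from C to D is a [Functor (op C) D]. *)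
Record Functor (C D : Category) := MkFunctor {
  functor_data :> FunctorData C D;
  fmap1 : forall A : C, fmap functor_data (idm A) = idm (functor_data A);
  fmapM : forall (A B E : C) (g : Hom B E) (f : Hom A B),
    fmap functor_data (g ∘ f) = fmap functor_data g ∘ fmap functor_data f }.

(* The identity of A, read as a morphism from A to B when A = B: it is how the
   identities between objects of a strict monoidal category are used to compare
   morphisms.  It does not depend on the proof of A = B, see [idto_irr]. *)
Definition idto (C : Category) (A B : C) (e : A = B) : Hom A B :=
  match e in _ = B return Hom A B with erefl => idm A end.

(* Strictness: the tensor product is associative and unital on the nose, on
   objects ([tensA], [tens1o], [tenso1]) and on morphisms ([tensmA], [tens1m],
   [tensm1], whose two sides are compared through [idto]). *)
Record StrictMonCat := MkStrictMonCat {
  smcat :> Category;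
  tensF : Functor (prodcat smcat smcat) smcat;
  munit : smcat;
  tensA : forall A B C : smcat,
    tensF (A, tensF (B, C)) = tensF (tensF (A, B), C);
  tens1o : forall A : smcat, tensF (munit, A) = A;
  tenso1 : forall A : smcat, tensF (A, munit) = A;
  tensmA : forall (A A' B B' C C' : smcat)
      (f : Hom A A') (g : Hom B B') (h : Hom C C'),
    idto (tensA A' B' C') ∘
      @fmap _ _ tensF (A, tensF (B, C)) (A', tensF (B', C'))
        (f, @fmap _ _ tensF (B, C) (B', C') (g, h))
    = @fmap _ _ tensF (tensF (A, B), C) (tensF (A', B'), C')
        (@fmap _ _ tensF (A, B) (A', B') (f, g), h)
      ∘ idto (tensA A B C);
  tens1m : forall (A A' : smcat) (f : Hom A A'),
    idto (tens1o A') ∘ @fmap _ _ tensF (munit, A) (munit, A') (idm munit, f)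
    = f ∘ idto (tens1o A);
  tensm1 : forall (A A' : smcat) (f : Hom A A'),
    idto (tenso1 A') ∘ @fmap _ _ tensF (A, munit) (A', munit) (f, idm munit)
    = f ∘ idto (tenso1 A) }.

Arguments munit {s}.
Arguments tensA {s} A B C.
Arguments tens1o {s} A.
Arguments tenso1 {s} A.

Definition tens (C : StrictMonCat) (A B : C) : C := tensF C (A, B).
Definition tensm (C : StrictMonCat) (A A' B B' : C)
    (f : Hom A A') (g : Hom B B') : Hom (tens A B) (tens A' B') :=
  @fmap _ _ (tensF C) (A, B) (A', B') (f, g).

Notation "A ⊗ B" := (tens A B) : cat_scope.
Notation "f ⊗₁ g" := (tensm f g) : cat_scope.

(* [mbraid_hex] is the hexagon, i.e. (id ⊗ c) ∘ (c ⊗ id) = c up to strict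
   associativity; the other hexagon follows from it and from [mbraidK]. *)
Record SymMonCat := MkSymMonCat {
  symcat :> StrictMonCat;
  mbraid : forall A B : symcat, Hom (A ⊗ B) (B ⊗ A);
  mbraid_nat : forall (A A' B B' : symcat) (f : Hom A A') (g : Hom B B'),
    mbraid A' B' ∘ (f ⊗₁ g) = (g ⊗₁ f) ∘ mbraid A B;
  mbraidK : forall A B : symcat, mbraid B A ∘ mbraid A B = idm (A ⊗ B);
  mbraid_hex : forall A B C : symcat,
    mbraid A (B ⊗ C) =
      idto (tensA B C A) ∘ (idm B ⊗₁ mbraid A C) ∘ idto (esym (tensA B A C))
      ∘ (mbraid A B ⊗₁ idm C) ∘ idto (tensA A B C) }.

Section Idto.
Variable C : Category.

Lemma idto_irr (A B : C) (e e' : A = B) : idto e = idto e'.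
Proof. by rewrite (proof_irrelevance _ e e'). Qed.

Lemma idto1 (A : C) (e : A = A) : idto e = idm A.
Proof. exact: (idto_irr e erefl). Qed.

Lemma idtoM (A B D : C) (e : A = B) (e' : B = D) :
  idto e' ∘ idto e = idto (etrans e e').
Proof. by case: _ / e'; rewrite comp1m. Qed.

Lemma idtoK (A B : C) (e : A = B) : idto (esym e) ∘ idto e = idm A.
Proof. by rewrite idtoM idto1. Qed.

Lemma idtoVK (A B : C) (e : A = B) : idto e ∘ idto (esym e) = idm B.
Proof. by rewrite idtoM idto1. Qed.

Lemma idto_op (A B : C) (e : A = B) : @idto (op C) A B e = idto (esym e).
Proof. by case: _ / e. Qed.

Lemma idto_swap (A A' B B' : C) (e : A = B) (e' : A' = B')
    (f : Hom A A') (g : Hom B B') :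
  idto e' ∘ f = g ∘ idto e -> idto (esym e') ∘ g = f ∘ idto (esym e).
Proof.
case: _ / e' g => g; case: _ / e g => g.
by rewrite /= !comp1m !compm1 => ->.
Qed.

End Idto.

Lemma fmap_idto (C D : Category) (F : Functor C D) (A B : C) (e : A = B) :
  fmap F (idto e) = idto (f_equal F e).
Proof. by case: _ / e; rewrite /= fmap1. Qed.

Section Tensor.
Variable C : StrictMonCat.
Implicit Types A B D E : C.

Lemma tensmM A B D A' B' D' (g : Hom B D) (f : Hom A B)
    (g' : Hom B' D') (f' : Hom A' B') :
  (g ∘ f) ⊗₁ (g' ∘ f') = (g ⊗₁ g') ∘ (f ⊗₁ f').
Proof.
exact: (@fmapM _ _ (tensF C) (A, A') (B, B') (D, D') (g, g') (f, f')).
Qed.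

Lemma tensm11 A B : idm A ⊗₁ idm B = idm (A ⊗ B).
Proof. exact: (@fmap1 _ _ (tensF C) (A, B)). Qed.

Lemma tensmMl A B D E (g : Hom B D) (f : Hom A B) :
  (g ∘ f) ⊗₁ idm E = (g ⊗₁ idm E) ∘ (f ⊗₁ idm E).
Proof. by rewrite -tensmM comp1m. Qed.

Lemma tensmMr A B D E (g : Hom B D) (f : Hom A B) :
  idm E ⊗₁ (g ∘ f) = (idm E ⊗₁ g) ∘ (idm E ⊗₁ f).
Proof. by rewrite -tensmM comp1m. Qed.

Lemma tensm_lr A B A' B' (f : Hom A A') (g : Hom B B') :
  (f ⊗₁ idm B') ∘ (idm A ⊗₁ g) = f ⊗₁ g.
Proof. by rewrite -tensmM comp1m compm1. Qed.

Lemma tensm_rl A B A' B' (f : Hom A A') (g : Hom B B') :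
  (idm A' ⊗₁ g) ∘ (f ⊗₁ idm B) = f ⊗₁ g.
Proof. by rewrite -tensmM comp1m compm1. Qed.

Lemma idto_tensl A B E (e : A = B) :
  idto e ⊗₁ idm E = idto (f_equal (fun X => X ⊗ E) e).
Proof. by case: _ / e; rewrite /= tensm11. Qed.

Lemma idto_tensr A B E (e : A = B) :
  idm E ⊗₁ idto e = idto (f_equal (fun X => E ⊗ X) e).
Proof. by case: _ / e; rewrite /= tensm11. Qed.

Lemma tensmAE A A' B B' D D' (f : Hom A A') (g : Hom B B') (h : Hom D D') :
  idto (tensA A' B' D') ∘ (f ⊗₁ (g ⊗₁ h))
  = ((f ⊗₁ g) ⊗₁ h) ∘ idto (tensA A B D).
Proof. exact: tensmA. Qed.

Lemma tensmAV A A' B B' D D' (f : Hom A A') (g : Hom B B') (h : Hom D D') :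
  idto (esym (tensA A' B' D')) ∘ ((f ⊗₁ g) ⊗₁ h)
  = (f ⊗₁ (g ⊗₁ h)) ∘ idto (esym (tensA A B D)).
Proof. by apply: idto_swap; apply: tensmAE. Qed.

Lemma tens1mE A A' (f : Hom A A') :
  idto (tens1o A') ∘ (idm munit ⊗₁ f) = f ∘ idto (tens1o A).
Proof. exact: tens1m. Qed.

Lemma tensm1E A A' (f : Hom A A') :
  idto (tenso1 A') ∘ (f ⊗₁ idm munit) = f ∘ idto (tenso1 A).
Proof. exact: tensm1. Qed.

Lemma tens1mV A A' (f : Hom A A') :
  idto (esym (tens1o A')) ∘ f = (idm munit ⊗₁ f) ∘ idto (esym (tens1o A)).
Proof. by apply: idto_swap; apply: tens1mE. Qed.

Lemma tensm1V A A' (f : Hom A A') :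
  idto (esym (tenso1 A')) ∘ f = (f ⊗₁ idm munit) ∘ idto (esym (tenso1 A)).
Proof. by apply: idto_swap; apply: tensm1E. Qed.

End Tensor.

Section OpMonoidal.
Variable C : StrictMonCat.

Definition op_tensF : Functor (prodcat (op C) (op C)) (op C) :=
  @MkFunctor (prodcat (op C) (op C)) (op C)
    (@MkFunctorData (prodcat (op C) (op C)) (op C) (fun p => tensF C p)
       (fun p q f => @fmap _ _ (tensF C) q p f))
    (fun p => @fmap1 _ _ (tensF C) p)
    (fun p q r g f => @fmapM _ _ (tensF C) r q p f g).

Lemma op_tensmA (A A' B B' D D' : op C)
    (f : Hom A A') (g : Hom B B') (h : Hom D D') :
  @idto (op C) _ _ (tensA (s:=C) A' B' D') ∘
    @fmap _ _ op_tensF (A, op_tensF (B, D)) (A', op_tensF (B', D'))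
      (f, @fmap _ _ op_tensF (B, D) (B', D') (g, h))
  = @fmap _ _ op_tensF (op_tensF (A, B), D) (op_tensF (A', B'), D')
      (@fmap _ _ op_tensF (A, B) (A', B') (f, g), h)
    ∘ @idto (op C) _ _ (tensA (s:=C) A B D).
Proof. by rewrite !idto_op; symmetry; exact: (@tensmAV C). Qed.

Lemma op_tens1m (A A' : op C) (f : Hom A A') :
  @idto (op C) _ _ (tens1o (s:=C) A') ∘
    @fmap _ _ op_tensF (munit (s:=C) : op C, A) (munit (s:=C) : op C, A')
      (@idm (op C) (munit (s:=C)), f)
  = f ∘ @idto (op C) _ _ (tens1o (s:=C) A).
Proof. by rewrite !idto_op; symmetry; exact: (@tens1mV C). Qed.

Lemma op_tensm1 (A A' : op C) (f : Hom A A') :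
  @idto (op C) _ _ (tenso1 (s:=C) A') ∘
    @fmap _ _ op_tensF (A, munit (s:=C) : op C) (A', munit (s:=C) : op C)
      (f, @idm (op C) (munit (s:=C)))
  = f ∘ @idto (op C) _ _ (tenso1 (s:=C) A).
Proof. by rewrite !idto_op; symmetry; exact: (@tensm1V C). Qed.

Definition op_mon : StrictMonCat :=
  @MkStrictMonCat (op C) op_tensF (munit (s:=C)) (tensA (s:=C))
    (tens1o (s:=C)) (tenso1 (s:=C)) op_tensmA op_tens1m op_tensm1.

End OpMonoidal.

Record Monoid (C : StrictMonCat) := MkMonoid {
  mcar :> C;
  mmul : Hom (mcar ⊗ mcar) mcar;
  mone : Hom munit mcar;
  mmulA : mmul ∘ (mmul ⊗₁ idm mcar) ∘ idto (tensA mcar mcar mcar)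
          = mmul ∘ (idm mcar ⊗₁ mmul);
  mmul1m : mmul ∘ (mone ⊗₁ idm mcar) = idto (tens1o mcar);
  mmulm1 : mmul ∘ (idm mcar ⊗₁ mone) = idto (tenso1 mcar) }.

Record is_monoid_mor (C : StrictMonCat) (M N : Monoid C) (f : Hom M N) : Prop :=
  MkIsMonoidMor {
    monmor_mul : f ∘ mmul M = mmul N ∘ (f ⊗₁ f);
    monmor_one : f ∘ mone M = mone N }.

Record Comonoid (D : StrictMonCat) := MkComonoid {
  ccar :> D;
  ccomul : Hom ccar (ccar ⊗ ccar);
  ccounit : Hom ccar munit;
  ccomulA : idto (tensA ccar ccar ccar) ∘ (idm ccar ⊗₁ ccomul) ∘ ccomul
            = (ccomul ⊗₁ idm ccar) ∘ ccomul;
  ccomul1m : (ccounit ⊗₁ idm ccar) ∘ ccomul = idto (esym (tens1o ccar));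
  ccomulm1 : (idm ccar ⊗₁ ccounit) ∘ ccomul = idto (esym (tenso1 ccar)) }.

Record is_comonoid_mor (D : StrictMonCat) (M N : Comonoid D) (f : Hom M N)
    : Prop := MkIsComonoidMor {
  comonmor_comul : ccomul N ∘ f = (f ⊗₁ f) ∘ ccomul M;
  comonmor_counit : ccounit N ∘ f = ccounit M }.

Arguments is_monoid_mor {C} M N f.
Arguments is_comonoid_mor {D} M N f.

(* [theta] is a family of bijections, with inverse [theta_inv]; [theta_nat]
   is naturality, jointly in X, V and W. *)
Record RelClosed (C : StrictMonCat) (P : C -> Prop) := MkRelClosed {
  ihom : Functor (prodcat (op (Full P)) (Full P)) C;
  theta : forall (X : C) (V W : Full P),
    Hom X (ihom (V, W)) -> Hom (X ⊗ sval V) (sval W);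
  theta_inv : forall (X : C) (V W : Full P),
    Hom (X ⊗ sval V) (sval W) -> Hom X (ihom (V, W));
  thetaK : forall X V W, cancel (@theta X V W) (@theta_inv X V W);
  theta_invK : forall X V W, cancel (@theta_inv X V W) (@theta X V W);
  theta_nat : forall (X X' : C) (V V' W W' : Full P)
      (x : Hom X' X) (g : Hom V' V) (h : Hom W W') (a : Hom X (ihom (V, W))),
    theta (@fmap _ _ ihom (V, W) (V', W') (g, h) ∘ a ∘ x)
    = fullm h ∘ theta a ∘ (x ⊗₁ fullm g) }.

Record RelCoclosed (D : StrictMonCat) (Q : D -> Prop) := MkRelCoclosed {
  cohom : Functor (prodcat (op (Full Q)) (Full Q)) D;
  vartheta : forall (V W : Full Q) (Z : D),
    Hom (cohom (V, W)) Z -> Hom (sval W) (Z ⊗ sval V);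
  vartheta_inv : forall (V W : Full Q) (Z : D),
    Hom (sval W) (Z ⊗ sval V) -> Hom (cohom (V, W)) Z;
  varthetaK : forall V W Z, cancel (@vartheta V W Z) (@vartheta_inv V W Z);
  vartheta_invK : forall V W Z, cancel (@vartheta_inv V W Z) (@vartheta V W Z);
  vartheta_nat : forall (V V' W W' : Full Q) (Z Z' : D)
      (g : Hom V V') (h : Hom W' W) (z : Hom Z Z') (a : Hom (cohom (V, W)) Z),
    vartheta (z ∘ a ∘ @fmap _ _ cohom (V', W') (V, W) (g, h))
    = (z ⊗₁ fullm g) ∘ vartheta a ∘ fullm h }.

Section End.
Variables (C : StrictMonCat) (P : C -> Prop) (H : RelClosed P).

Definition hommap (V V' W W' : Full P) (g : Hom V' V) (h : Hom W W') :
    Hom (ihom H (V, W)) (ihom H (V', W')) :=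
  @fmap _ _ (ihom H) (V, W) (V', W') (g, h).

Definition ev (V W : Full P) : Hom (ihom H (V, W) ⊗ sval V) (sval W) :=
  theta (idm (ihom H (V, W))).

Lemma hommap1 V W : hommap (idm V) (idm W) = idm (ihom H (V, W)).
Proof. exact: (@fmap1 _ _ (ihom H) (V, W)). Qed.

Lemma hommapM (V V' V'' W W' W'' : Full P) (g' : Hom V'' V') (g : Hom V' V)
    (h' : Hom W' W'') (h : Hom W W') :
  hommap (V:=V) (g ∘ g') (h' ∘ h) = hommap g' h' ∘ hommap g h.
Proof.
exact: (@fmapM _ _ (ihom H) (V, W) (V', W') (V'', W'') (g', h') (g, h)).
Qed.

Lemma thetaE (X : C) (V W : Full P) (a : Hom X (ihom H (V, W))) :
  theta a = ev V W ∘ (a ⊗₁ idm (sval V)).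
Proof.
have := theta_nat a (idm V) (idm W) (idm (ihom H (V, W))).
by rewrite compm1 -/(hommap _ _) hommap1 !comp1m.
Qed.

Lemma theta_inj (X : C) (V W : Full P) (a b : Hom X (ihom H (V, W))) :
  theta a = theta b -> a = b.
Proof. by move=> e; rewrite -[a]thetaK e thetaK. Qed.

Section EndV.
Variable V : Full P.
Let E := ihom H (V, V).

Definition end_mul : Hom (E ⊗ E) E :=
  theta_inv H (ev V V ∘ (idm E ⊗₁ ev V V) ∘ idto (esym (tensA E E (sval V)))).

Definition end_one : Hom munit E :=
  theta_inv H (idto (tens1o (sval V)) : Hom (munit ⊗ sval V) (sval V)).

Lemma ev_mul : ev V V ∘ (end_mul ⊗₁ idm (sval V)) =
  ev V V ∘ (idm E ⊗₁ ev V V) ∘ idto (esym (tensA E E (sval V))).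
Proof. by rewrite -thetaE theta_invK. Qed.

Lemma ev_one : ev V V ∘ (end_one ⊗₁ idm (sval V)) = idto (tens1o (sval V)).
Proof. by rewrite -thetaE theta_invK. Qed.

Lemma end_mulA :
  end_mul ∘ (end_mul ⊗₁ idm E) ∘ idto (tensA E E E)
  = end_mul ∘ (idm E ⊗₁ end_mul).
Proof.
apply: theta_inj; rewrite !thetaE !tensmMl !compA ev_mul.
rewrite -!(compA _ (idto (esym _))) tensmAV tensm11.
rewrite !compA -(compA (ev V V)) tensm_rl -tensm_lr !compA ev_mul.
rewrite -(compA _ _ (idm (E ⊗ E) ⊗₁ _)) -tensm11 tensmAV.
rewrite -[RHS]compA tensmAV -!compA !idto_tensl.
rewrite (compA (idm E ⊗₁ ev V V) (idm E ⊗₁ (end_mul ⊗₁ _))).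
rewrite -tensmMr ev_mul !tensmMr idto_tensr -!compA !idtoM.
by do 3 f_equal; apply: idto_irr.
Qed.

Lemma end_mul1m : end_mul ∘ (end_one ⊗₁ idm E) = idto (tens1o E).
Proof.
apply: theta_inj; rewrite !thetaE !tensmMl !compA ev_mul.
rewrite -(compA _ (idto (esym _))) tensmAV tensm11.
rewrite !compA -(compA (ev V V)) tensm_rl -tensm_lr !compA ev_one.
rewrite tens1mE idto_tensl -compA idtoM.
by f_equal; apply: idto_irr.
Qed.

Lemma end_mulm1 : end_mul ∘ (idm E ⊗₁ end_one) = idto (tenso1 E).
Proof.
apply: theta_inj; rewrite !thetaE !tensmMl !compA ev_mul.
rewrite -(compA _ (idto (esym _))) tensmAV.
rewrite !compA -(compA (ev V V)) -tensmMr ev_one.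
rewrite idto_tensr idto_tensl -compA idtoM.
by f_equal; apply: idto_irr.
Qed.

Definition end_monoid : Monoid C := MkMonoid end_mulA end_mul1m end_mulm1.

End EndV.
End End.

Section Coend.
Variables (D : StrictMonCat) (Q : D -> Prop) (H : RelCoclosed Q).

Definition cohommap (V V' W W' : Full Q) (g : Hom V V') (h : Hom W' W) :
    Hom (cohom H (V', W')) (cohom H (V, W)) :=
  @fmap _ _ (cohom H) (V', W') (V, W) (g, h).

Definition coev (V W : Full Q) : Hom (sval W) (cohom H (V, W) ⊗ sval V) :=
  vartheta (idm (cohom H (V, W))).

Lemma cohommap1 V W : cohommap (idm V) (idm W) = idm (cohom H (V, W)).
Proof. exact: (@fmap1 _ _ (cohom H) (V, W)). Qed.

Lemma cohommapM (V V' V'' W W' W'' : Full Q) (g' : Hom V' V'') (g : Hom V V')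
    (h' : Hom W'' W') (h : Hom W' W) :
  cohommap (g' ∘ g) (h ∘ h') = cohommap g h ∘ cohommap g' h'.
Proof.
exact: (@fmapM _ _ (cohom H) (V'', W'') (V', W') (V, W) (g, h) (g', h')).
Qed.

Lemma varthetaE (V W : Full Q) (Z : D) (a : Hom (cohom H (V, W)) Z) :
  vartheta a = (a ⊗₁ idm (sval V)) ∘ coev V W.
Proof.
have := vartheta_nat (idm V) (idm W) a (idm (cohom H (V, W))).
by rewrite compm1 -/(cohommap _ _) cohommap1 !compm1.
Qed.

Lemma vartheta_inj (V W : Full Q) (Z : D) (a b : Hom (cohom H (V, W)) Z) :
  vartheta a = vartheta b -> a = b.
Proof. by move=> e; rewrite -[a]varthetaK e varthetaK. Qed.

Section CoendV.
Variable V : Full Q.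
Let E := cohom H (V, V).

Definition coend_comul : Hom E (E ⊗ E) :=
  vartheta_inv H (idto (tensA E E (sval V)) ∘ (idm E ⊗₁ coev V V) ∘ coev V V).

Definition coend_counit : Hom E munit :=
  vartheta_inv H (idto (esym (tens1o (sval V)))
                : Hom (sval V) (munit ⊗ sval V)).

Lemma coev_comul : (coend_comul ⊗₁ idm (sval V)) ∘ coev V V =
  idto (tensA E E (sval V)) ∘ (idm E ⊗₁ coev V V) ∘ coev V V.
Proof. by rewrite -varthetaE vartheta_invK. Qed.

Lemma coev_counit : (coend_counit ⊗₁ idm (sval V)) ∘ coev V V
  = idto (esym (tens1o (sval V))).
Proof. by rewrite -varthetaE vartheta_invK. Qed.

Lemma coend_comulA :
  idto (tensA E E E) ∘ (idm E ⊗₁ coend_comul) ∘ coend_comul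
  = (coend_comul ⊗₁ idm E) ∘ coend_comul.
Proof.
apply: vartheta_inj; rewrite !varthetaE !tensmMl -!compA coev_comul !compA.
rewrite -[in RHS]tensmAE tensm11.
rewrite -(compA _ (coend_comul ⊗₁ idm (E ⊗ sval V))) tensm_lr.
rewrite -(tensm_rl coend_comul (coev V V)) !compA.
rewrite -[RHS]compA coev_comul !compA -[idm (E ⊗ E)]tensm11.
rewrite -(compA _ ((idm E ⊗₁ idm E) ⊗₁ _)) -tensmAE !compA.
rewrite -(compA _ ((idm E ⊗₁ coend_comul) ⊗₁ _)) -tensmAE !compA.
rewrite -(compA _ (idm E ⊗₁ (coend_comul ⊗₁ _))) -tensmMr coev_comul.
rewrite !tensmMr !compA idto_tensr idto_tensl !idtoM.
by do 3 f_equal; apply: idto_irr.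
Qed.

Lemma coend_comul1m :
  (coend_counit ⊗₁ idm E) ∘ coend_comul = idto (esym (tens1o E)).
Proof.
apply: vartheta_inj; rewrite !varthetaE !tensmMl -!compA coev_comul !compA.
rewrite -tensmAE tensm11 -(compA _ (coend_counit ⊗₁ _)) tensm_lr.
rewrite -(tensm_rl coend_counit (coev V V)).
rewrite -!compA coev_counit -tens1mV !compA idto_tensl idtoM.
by f_equal; apply: idto_irr.
Qed.

Lemma coend_comulm1 :
  (idm E ⊗₁ coend_counit) ∘ coend_comul = idto (esym (tenso1 E)).
Proof.
apply: vartheta_inj; rewrite !varthetaE !tensmMl -!compA coev_comul !compA.
rewrite -tensmAE -(compA _ (idm E ⊗₁ (coend_counit ⊗₁ _))) -tensmMr coev_counit.
rewrite idto_tensr idto_tensl idtoM.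
by f_equal; apply: idto_irr.
Qed.

Definition coend_comonoid : Comonoid D :=
  MkComonoid coend_comulA coend_comul1m coend_comulm1.

End CoendV.
End Coend.

Section Rep.
Variables (C : StrictMonCat) (P : C -> Prop) (H : RelClosed P) (M : Monoid C).

Record RepObj := MkRepObj {
  rep_obj : Full P;
  rep_map : Hom M (end_monoid H rep_obj);
  rep_mapP : is_monoid_mor M (end_monoid H rep_obj) rep_map }.

Definition is_rep_mor (R S : RepObj) (f : Hom (rep_obj R) (rep_obj S)) : Prop :=
  hommap H (idm (rep_obj R)) f ∘ rep_map R
  = hommap H f (idm (rep_obj S)) ∘ rep_map S.

Record RepHom (R S : RepObj) := MkRepHom {
  rep_hom : Hom (rep_obj R) (rep_obj S);
  rep_homP : is_rep_mor rep_hom }.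

Lemma rep_hom_inj (R S : RepObj) (f g : RepHom R S) :
  rep_hom f = rep_hom g -> f = g.
Proof.
case: f g => f fP [g gP] /= e; case: _ / e gP => gP.
by rewrite (proof_irrelevance _ fP gP).
Qed.

Lemma rep_id_subproof (R : RepObj) : is_rep_mor (idm (rep_obj R)).
Proof. by []. Qed.

Lemma rep_comp_subproof (R S T : RepObj) (g : RepHom S T) (f : RepHom R S) :
  is_rep_mor (rep_hom g ∘ rep_hom f).
Proof.
have fP := rep_homP f; have gP := rep_homP g; rewrite /is_rep_mor in fP gP *.
rewrite -[X in hommap H X (_ ∘ _)](comp1m (idm _)) hommapM -compA fP compA.
rewrite -hommapM !compm1.
have -> : hommap H (rep_hom f) (rep_hom g)
    = hommap H (rep_hom f) (idm _) ∘ hommap H (idm _) (rep_hom g).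
  by rewrite -hommapM !comp1m.
by rewrite -compA gP compA -hommapM comp1m.
Qed.

Definition Rep : Category.
Proof.
refine (@MkCategory RepObj RepHom
  (fun R => MkRepHom (rep_id_subproof R))
  (fun R S T g f => MkRepHom (rep_comp_subproof g f)) _ _ _).
- by move=> R S f; apply: rep_hom_inj; apply: comp1m.
- by move=> R S f; apply: rep_hom_inj; apply: compm1.
- by move=> R S T U h g f; apply: rep_hom_inj; apply: compA.
Defined.

End Rep.

Arguments MkRepObj {C P} H M rep_obj rep_map rep_mapP.
Arguments MkRepHom {C P H M} R S rep_hom rep_homP.

Section Corep.
Variables (D : StrictMonCat) (Q : D -> Prop) (H : RelCoclosed Q).
Variable O : Comonoid D.

Record CorepObj := MkCorepObj {
  corep_obj : Full Q;
  corep_map : Hom (coend_comonoid H corep_obj) O;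
  corep_mapP : is_comonoid_mor (coend_comonoid H corep_obj) O corep_map }.

Definition is_corep_mor (R S : CorepObj)
    (f : Hom (corep_obj R) (corep_obj S)) : Prop :=
  corep_map R ∘ cohommap H f (idm (corep_obj R))
  = corep_map S ∘ cohommap H (idm (corep_obj S)) f.

Record CorepHom (R S : CorepObj) := MkCorepHom {
  corep_hom : Hom (corep_obj R) (corep_obj S);
  corep_homP : is_corep_mor corep_hom }.

Lemma corep_hom_inj (R S : CorepObj) (f g : CorepHom R S) :
  corep_hom f = corep_hom g -> f = g.
Proof.
case: f g => f fP [g gP] /= e; case: _ / e gP => gP.
by rewrite (proof_irrelevance _ fP gP).
Qed.

Lemma corep_id_subproof (R : CorepObj) : is_corep_mor (idm (corep_obj R)).
Proof. by []. Qed.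

Lemma corep_comp_subproof (R S T : CorepObj)
    (g : CorepHom S T) (f : CorepHom R S) :
  is_corep_mor (corep_hom g ∘ corep_hom f).
Proof.
have fP := corep_homP f; have gP := corep_homP g.
rewrite /is_corep_mor in fP gP *.
rewrite -[X in cohommap H (_ ∘ _) X](comp1m (idm _)) cohommapM compA fP -compA.
rewrite -cohommapM !compm1.
have -> : cohommap H (corep_hom g) (corep_hom f)
    = cohommap H (corep_hom g) (idm _) ∘ cohommap H (idm _) (corep_hom f).
  by rewrite -cohommapM !comp1m.
by rewrite compA gP -compA -cohommapM comp1m.
Qed.

Definition Corep : Category.
Proof.
refine (@MkCategory CorepObj CorepHom
  (fun R => MkCorepHom (corep_id_subproof R))
  (fun R S T g f => MkCorepHom (corep_comp_subproof g f)) _ _ _).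
- by move=> R S f; apply: corep_hom_inj; apply: comp1m.
- by move=> R S f; apply: corep_hom_inj; apply: compm1.
- by move=> R S T U h g f; apply: corep_hom_inj; apply: compA.
Defined.

End Corep.

Arguments MkCorepObj {D Q} H O corep_obj corep_map corep_mapP.
Arguments MkCorepHom {D Q H O} R S corep_hom corep_homP.
Arguments is_corep_mor {D Q H O} R S f.

Record ColaxFunctor (C D : StrictMonCat) := MkColaxFunctor {
  cfun :> Functor C D;
  colax1 : Hom (cfun munit) munit;
  colax2 : forall A B : C, Hom (cfun (A ⊗ B)) (cfun A ⊗ cfun B);
  colax2_nat : forall (A A' B B' : C) (f : Hom A A') (g : Hom B B'),
    colax2 A' B' ∘ fmap cfun (f ⊗₁ g)
    = (fmap cfun f ⊗₁ fmap cfun g) ∘ colax2 A B;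
  colaxA : forall A B E : C,
    idto (tensA (cfun A) (cfun B) (cfun E))
      ∘ (idm (cfun A) ⊗₁ colax2 B E) ∘ colax2 A (B ⊗ E)
    = (colax2 A B ⊗₁ idm (cfun E)) ∘ colax2 (A ⊗ B) E
      ∘ fmap cfun (idto (tensA A B E));
  colax1m : forall A : C,
    idto (tens1o (cfun A)) ∘ (colax1 ⊗₁ idm (cfun A)) ∘ colax2 munit A
    = fmap cfun (idto (tens1o A));
  colaxm1 : forall A : C,
    idto (tenso1 (cfun A)) ∘ (idm (cfun A) ⊗₁ colax1) ∘ colax2 A munit
    = fmap cfun (idto (tenso1 A)) }.

(* A contravariant colax monoidal functor from C to D is a colax monoidal
   functor from the opposite monoidal category of C to D. *)
Notation ContraColaxFunctor C D := (ColaxFunctor (op_mon C) D).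

Section ContraColax.
Variables (C D : StrictMonCat) (F : ContraColaxFunctor C D).

Definition cmap (A B : C) (f : Hom A B) : Hom (F B) (F A) :=
  @fmap (op C) D F B A f.

Definition cphi (A B : C) : Hom (F (A ⊗ B)) (F A ⊗ F B) := @colax2 _ _ F A B.

Definition cphi0 : Hom (F (munit (s:=C))) munit := colax1 F.

Lemma cmapM (A B E : C) (g : Hom B E) (f : Hom A B) :
  cmap (g ∘ f) = cmap f ∘ cmap g.
Proof. exact: (@fmapM (op C) D F E B A f g). Qed.

Lemma cmap1 (A : C) : cmap (idm A) = idm (F A).
Proof. exact: (@fmap1 (op C) D F A). Qed.

Lemma cphi_nat (A A' B B' : C) (f : Hom A A') (g : Hom B B') :
  cphi A B ∘ cmap (f ⊗₁ g) = (cmap f ⊗₁ cmap g) ∘ cphi A' B'.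
Proof. exact: (@colax2_nat _ _ F A' A B' B f g). Qed.

Lemma cmap_idto (A B : C) (e : A = B) :
  cmap (idto e) = idto (f_equal F (esym e)).
Proof. by case: _ / e; rewrite /= cmap1. Qed.

Lemma cphiA (A B E : C) :
  idto (tensA (F A) (F B) (F E)) ∘ (idm (F A) ⊗₁ cphi B E) ∘ cphi A (B ⊗ E)
  = (cphi A B ⊗₁ idm (F E)) ∘ cphi (A ⊗ B) E
    ∘ cmap (idto (esym (tensA A B E))).
Proof.
have := @colaxA _ _ F A B E.
by rewrite (@idto_op C); apply.
Qed.

Lemma cphi1m (A : C) :
  idto (tens1o (F A)) ∘ (cphi0 ⊗₁ idm (F A)) ∘ cphi munit A
  = cmap (idto (esym (tens1o A))).
Proof. by have := @colax1m _ _ F A; rewrite (@idto_op C); apply. Qed.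

Lemma cphim1 (A : C) :
  idto (tenso1 (F A)) ∘ (idm (F A) ⊗₁ cphi0) ∘ cphi A munit
  = cmap (idto (esym (tenso1 A))).
Proof. by have := @colaxm1 _ _ F A; rewrite (@idto_op C); apply. Qed.

Section Comon.
Variable M : Monoid C.

Definition Comon_comul : Hom (F M) (F M ⊗ F M) := cphi M M ∘ cmap (mmul M).

Definition Comon_counit : Hom (F M) munit := cphi0 ∘ cmap (mone M).

Lemma Comon_comulA :
  idto (tensA (F M) (F M) (F M)) ∘ (idm (F M) ⊗₁ Comon_comul) ∘ Comon_comul
  = (Comon_comul ⊗₁ idm (F M)) ∘ Comon_comul.
Proof.
rewrite /Comon_comul tensmMr tensmMl !compA.
rewrite -(compA _ (idm _ ⊗₁ cmap _)) -cmap1 -cphi_nat.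
rewrite -(compA _ (cmap _ ⊗₁ _)) -cphi_nat.
rewrite !compA cmap1 cphiA -!compA -!cmapM.
rewrite (_ : mmul M ∘ _ ∘ _ = mmul M ∘ (mmul M ⊗₁ idm M)) //.
by rewrite -[RHS]compm1 -(idtoVK (tensA M M M)) !compA mmulA.
Qed.

Lemma Comon_comul1m :
  (Comon_counit ⊗₁ idm (F M)) ∘ Comon_comul = idto (esym (tens1o (F M))).
Proof.
rewrite /Comon_counit /Comon_comul tensmMl -cmap1 !compA.
rewrite -(compA _ (cmap _ ⊗₁ _)) -cphi_nat cmap1 -!compA -cmapM mmul1m.
rewrite -[LHS]comp1m -(idtoK (tens1o (F M))) -!compA (compA (idto (tens1o _))).
rewrite (compA _ (cphi _ _)) cphi1m -cmapM idtoVK cmap1.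
by rewrite compm1.
Qed.

Lemma Comon_comulm1 :
  (idm (F M) ⊗₁ Comon_counit) ∘ Comon_comul = idto (esym (tenso1 (F M))).
Proof.
rewrite /Comon_counit /Comon_comul tensmMr -cmap1 !compA.
rewrite -(compA _ (_ ⊗₁ cmap _)) -cphi_nat cmap1 -!compA -cmapM mmulm1.
rewrite -[LHS]comp1m -(idtoK (tenso1 (F M))) -!compA (compA (idto (tenso1 _))).
rewrite (compA _ (cphi _ _)) cphim1 -cmapM idtoVK cmap1.
by rewrite compm1.
Qed.

Definition Comon : Comonoid D :=
  MkComonoid Comon_comulA Comon_comul1m Comon_comulm1.

End Comon.

Section Induced.
Variables (P : C -> Prop) (Q : D -> Prop).
Variables (clC : RelClosed P) (coD : RelCoclosed Q).
Hypothesis FPQ : forall V : C, P V -> Q (F V).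

Definition restr (V : Full P) : Full Q := exist Q (F (sval V)) (FPQ (svalP V)).

Definition Phi (V W : Full P) :
    Hom (cohom coD (restr V, restr W)) (F (ihom clC (V, W))) :=
  @vartheta_inv _ _ coD (restr V) (restr W) _
    (cphi (ihom clC (V, W)) (sval V) ∘ cmap (ev clC V W)).

End Induced.
End ContraColax.

Arguments restr {C D} F {P Q} FPQ V.
Arguments Phi {C D} F {P Q} clC coD FPQ V W.

(* Main.v *)
From mathcomp Require Import ssreflect ssrfun ssrbool.
Require Import Defs.

(** Under the adjunction [theta], a morphism [r : M -> end(V)] corresponds to a
    morphism [theta r : M ⊗ V -> V], and [r] is a morphism of monoids exactly
    when [theta r] is an action of [M] on [V].  Dually, under [vartheta], a
    morphism of comonoids [w : coend(V) -> O] is the same as a coaction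
    [V -> O ⊗ V].  A contravariant colax monoidal functor [F] turns an action
    [a : M ⊗ V -> V] into the coaction [cphi M V ∘ cmap F a] of the comonoid
    [F M] on [F V]: this is naturality, associativity and unitality of [cphi].
    The canonical morphism [Phi] is made so that both correspondences match:
    [vartheta (cmap F a ∘ Phi V W) = cphi X V ∘ cmap F (theta a)] for every
    [a : X -> hom(V, W)] ([vartheta_cmap_Phi]).  Hence [F r ∘ Phi] is the
    morphism whose transpose is the coaction induced by [theta r], so it is a
    morphism of comonoids.

    Morphisms are treated in the same way: the compatibility condition of [Rep]
    says, after transposition, that [f] is equivariant for the actions
    ([is_rep_morE]), and that of [Corep] that it is equivariant for the
    coactions ([is_corep_morE]); [F] turns the former into the latter by
    naturality of [cphi].  Functoriality is that of [F]. *)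

Set Implicit Arguments.
Unset Strict Implicit.
Unset Printing Implicit Defensive.

Local Open Scope cat_scope.

Section Actions.
Variables (C : StrictMonCat) (P : C -> Prop) (H : RelClosed P).

Lemma theta_hommap (X : C) (V V' W W' : Full P) (g : Hom V' V) (h : Hom W W')
    (a : Hom X (ihom H (V, W))) :
  theta (hommap H g h ∘ a) = fullm h ∘ theta a ∘ (idm X ⊗₁ fullm g).
Proof. by rewrite -theta_nat compm1. Qed.

Lemma theta_comp (X X' : C) (V W : Full P) (a : Hom X (ihom H (V, W)))
    (x : Hom X' X) :
  theta (a ∘ x) = theta a ∘ (x ⊗₁ idm (sval V)).
Proof. by rewrite !thetaE tensmMl compA. Qed.

Variable M : Monoid C.

Lemma monoid_mor_action_mul (V : Full P) (r : Hom M (end_monoid H V)) :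
  is_monoid_mor M (end_monoid H V) r ->
  theta (V:=V) (W:=V) r ∘ (mmul M ⊗₁ idm (sval V))
  = theta (V:=V) (W:=V) r ∘ (idm (mcar M) ⊗₁ theta (V:=V) (W:=V) r)
    ∘ idto (esym (tensA (mcar M) (mcar M) (sval V))).
Proof.
case=> rM _; rewrite -theta_comp rM thetaE tensmMl compA [X in X ∘ _]ev_mul.
rewrite -!compA tensmAV !thetaE !compA; congr (_ ∘ _).
by rewrite -!compA -!tensmM !comp1m compm1.
Qed.

Lemma monoid_mor_action_one (V : Full P) (r : Hom M (end_monoid H V)) :
  is_monoid_mor M (end_monoid H V) r ->
  theta (V:=V) (W:=V) r ∘ (mone M ⊗₁ idm (sval V)) = idto (tens1o (sval V)).
Proof. by case=> _ r1; rewrite -theta_comp r1 thetaE; apply: ev_one. Qed.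

(** A morphism of representations is an equivariant morphism. *)
Lemma is_rep_morE (R S : RepObj H M) (f : Hom (rep_obj R) (rep_obj S)) :
  is_rep_mor f <->
  fullm f ∘ theta (V:=rep_obj R) (W:=rep_obj R) (rep_map R)
  = theta (V:=rep_obj S) (W:=rep_obj S) (rep_map S)
    ∘ (idm (mcar M) ⊗₁ fullm f).
Proof.
have eR := theta_hommap (idm (rep_obj R)) f (rep_map R).
have eS := theta_hommap f (idm (rep_obj S)) (rep_map S).
rewrite [X in _ ⊗₁ X]/(idm _) tensm11 compm1 in eR; rewrite comp1m in eS.
by split=> [e|e]; [rewrite -eR -eS e | apply: theta_inj; rewrite eR eS].
Qed.

End Actions.

Section Coactions.
Variables (D : StrictMonCat) (Q : D -> Prop) (H : RelCoclosed Q).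

Lemma vartheta_cohommap (V V' W W' : Full Q) (Z : D) (g : Hom V V')
    (h : Hom W' W) (a : Hom (cohom H (V, W)) Z) :
  vartheta (a ∘ cohommap H g h) = (idm Z ⊗₁ fullm g) ∘ vartheta a ∘ fullm h.
Proof. by rewrite -vartheta_nat comp1m. Qed.

Lemma vartheta_comp (V W : Full Q) (Z Z' : D) (z : Hom Z Z')
    (a : Hom (cohom H (V, W)) Z) :
  vartheta (z ∘ a) = (z ⊗₁ idm (sval V)) ∘ vartheta a.
Proof. by rewrite !varthetaE tensmMl compA. Qed.

Variable O : Comonoid D.

Lemma coaction_comonoid_mor (V : Full Q) (w : Hom (coend_comonoid H V) O) :
  (ccomul O ⊗₁ idm (sval V)) ∘ vartheta (V:=V) (W:=V) w
  = idto (tensA (ccar O) (ccar O) (sval V))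
    ∘ (idm (ccar O) ⊗₁ vartheta (V:=V) (W:=V) w) ∘ vartheta (V:=V) (W:=V) w ->
  (ccounit O ⊗₁ idm (sval V)) ∘ vartheta (V:=V) (W:=V) w
  = idto (esym (tens1o (sval V))) ->
  is_comonoid_mor (coend_comonoid H V) O w.
Proof.
move=> wM w1; split; apply: (vartheta_inj (V:=V) (W:=V)); rewrite vartheta_comp.
  rewrite wM vartheta_comp [in RHS]varthetaE coev_comul !compA -tensmAE.
  rewrite !varthetaE -!compA; congr (_ ∘ _); rewrite !compA; congr (_ ∘ _).
  by rewrite -!tensmM !comp1m !compm1.
by rewrite w1 varthetaE; symmetry; apply: coev_counit.
Qed.

(** A morphism of corepresentations is an equivariant morphism. *)
Lemma is_corep_morE (R S : CorepObj H O) (f : Hom (corep_obj R) (corep_obj S)) :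
  is_corep_mor R S f <->
  (idm (ccar O) ⊗₁ fullm f)
    ∘ vartheta (V:=corep_obj R) (W:=corep_obj R) (corep_map R)
  = vartheta (V:=corep_obj S) (W:=corep_obj S) (corep_map S) ∘ fullm f.
Proof.
have eR := vartheta_cohommap f (idm (corep_obj R)) (corep_map R).
have eS := vartheta_cohommap (idm (corep_obj S)) f (corep_map S).
rewrite compm1 in eR; rewrite [X in _ ⊗₁ X]/(idm _) tensm11 comp1m in eS.
by split=> [e|e]; [rewrite -eR -eS e | apply: vartheta_inj; rewrite eR eS].
Qed.

End Coactions.

Section ColaxImage.
Variables (C D : StrictMonCat) (F : ContraColaxFunctor C D) (M : Monoid C).

(** [F] turns actions of [M] into coactions of [Comon F M]; the unit law is
    [action_coaction_counit]. *)
Lemma action_coaction_comul (V : C) (a : Hom (mcar M ⊗ V) V) :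
  a ∘ (mmul M ⊗₁ idm V)
  = a ∘ (idm (mcar M) ⊗₁ a) ∘ idto (esym (tensA (mcar M) (mcar M) V)) ->
  (Comon_comul F M ⊗₁ idm (F V)) ∘ (cphi F M V ∘ cmap F a)
  = idto (tensA (F M) (F M) (F V)) ∘ (idm (F M) ⊗₁ (cphi F M V ∘ cmap F a))
    ∘ (cphi F M V ∘ cmap F a).
Proof.
move=> aM; rewrite /Comon_comul tensmMl tensmMr !compA -!cmap1.
rewrite -(compA _ (cmap F (mmul M) ⊗₁ _)) -cphi_nat.
rewrite -(compA _ (_ ⊗₁ cmap F a)) -cphi_nat !cmap1 !compA cphiA.
by rewrite -!compA -!cmapM aM compA.
Qed.

Lemma action_coaction_counit (V : C) (a : Hom (mcar M ⊗ V) V) :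
  a ∘ (mone M ⊗₁ idm V) = idto (tens1o V) ->
  (Comon_counit F M ⊗₁ idm (F V)) ∘ (cphi F M V ∘ cmap F a)
  = idto (esym (tens1o (F V))).
Proof.
move=> a1; rewrite /Comon_counit tensmMl !compA -cmap1.
rewrite -(compA _ (cmap F (mone M) ⊗₁ _)) -cphi_nat cmap1 -!compA -cmapM a1.
rewrite -[LHS]comp1m -(idtoK (tens1o (F V))) -compA.
by rewrite (compA (idto (tens1o _))) (compA _ (cphi _ _ _)) cphi1m -cmapM
  idtoVK cmap1 compm1.
Qed.

Variables (P : C -> Prop) (Q : D -> Prop).
Variables (clC : RelClosed P) (coD : RelCoclosed Q).
Variable FPQ : forall V : C, P V -> Q (F V).

(** The transpose of [cmap F a ∘ Phi V W] is the image under [F] of the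
    transpose of [a]. *)
Lemma vartheta_cmap_Phi (X : C) (V W : Full P) (a : Hom X (ihom clC (V, W))) :
  vartheta (cmap F a ∘ Phi F clC coD FPQ V W)
  = cphi F X (sval V) ∘ cmap F (theta a).
Proof.
rewrite vartheta_comp vartheta_invK thetaE cmapM !compA; congr (_ ∘ _).
by rewrite cphi_nat cmap1.
Qed.

Lemma cmap_Phi_comonoid_mor (V : Full P) (r : Hom M (end_monoid clC V)) :
  is_monoid_mor M (end_monoid clC V) r ->
  is_comonoid_mor (coend_comonoid coD (restr F FPQ V)) (Comon F M)
    (cmap F r ∘ Phi F clC coD FPQ V V).
Proof.
move=> rP; apply: coaction_comonoid_mor; rewrite vartheta_cmap_Phi.
  by apply: action_coaction_comul; apply: monoid_mor_action_mul.
by apply: action_coaction_counit; apply: monoid_mor_action_one.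
Qed.

End ColaxImage.

Theorem theorem3p31 (C D : SymMonCat) (P : C -> Prop) (Q : D -> Prop)
    (clC : RelClosed P) (coD : RelCoclosed Q)
    (M : Monoid C) (F : ContraColaxFunctor C D)
    (FPQ : forall V : C, P V -> Q (F V)) :
  exists objP : forall R : Rep clC M,
    is_comonoid_mor (coend_comonoid coD (restr F FPQ (rep_obj R))) (Comon F M)
      (cmap F (rep_map R) ∘ Phi F clC coD FPQ (rep_obj R) (rep_obj R)),
  let obj (R : Rep clC M) : Corep coD (Comon F M) :=
    MkCorepObj coD (Comon F M) (restr F FPQ (rep_obj R))
      (cmap F (rep_map R) ∘ Phi F clC coD FPQ (rep_obj R) (rep_obj R))
      (objP R) in
  exists morP : forall (R S : Rep clC M) (f : Hom R S),
    is_corep_mor (obj S) (obj R) (cmap F (rep_hom f)),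
  exists G : Functor (op (Rep clC M)) (Corep coD (Comon F M)),
    functor_data G =
    @MkFunctorData (op (Rep clC M)) (Corep coD (Comon F M)) obj
      (fun S R (f : @Hom (Rep clC M) R S) =>
         MkCorepHom (obj S) (obj R) (cmap F (rep_hom f)) (morP R S f)).
Proof.
have objP (R : Rep clC M) :=
  cmap_Phi_comonoid_mor coD FPQ (rep_mapP R).
exists objP => obj.
have morP (R S : Rep clC M) (f : Hom R S) :
    is_corep_mor (obj S) (obj R) (cmap F (rep_hom f)).
  apply/is_corep_morE; rewrite /= !vartheta_cmap_Phi.
  have /is_rep_morE fP := rep_homP f.
  rewrite -compA -cmapM [in RHS]fP.
  by rewrite cmapM !compA cphi_nat cmap1.
exists morP.
unshelve eexists (@MkFunctor _ _ (@MkFunctorData (op (Rep clC M))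
  (Corep coD (Comon F M)) obj (fun S R (f : @Hom (Rep clC M) R S) =>
    MkCorepHom (obj S) (obj R) (cmap F (rep_hom f)) (morP R S f))) _ _).
- by move=> R; apply: corep_hom_inj; apply: cmap1.
- by move=> R S T g f; apply: corep_hom_inj; apply: cmapM.
- by [].
Qed.
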